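(* Let $a=(|a_n|)_{n\ge 0}$ be a fixed sequence with $|a_n|$ decreasing to $0$ for $n\ge n_0$, put $\mu_n=-\ln|a_n|$, and suppose that $$\sum_{n=n_0}^{+\infty}\frac{1}{\mu_{n+1}-\mu_n}<+\infty .$$ Let $h\in\mathcal{L}_+$, $\Phi\in\mathcal{L}$ with inverse function $\varphi$, and let $F(z)=\sum_{n=0}^{+\infty}a_ne^{z\lambda_n}$ belong to $\mathcal{D}_a(\Phi)$. If $$(\forall\, b>0)\colon\quad \sum_{n=n_0}^{+\infty} h\left(\varphi(\lambda_n)\cdot\Big(1+\frac{b}{\mu_{n+1}-\mu_n}\Big)\right)\frac{1}{\mu_{n+1}-\mu_n}<+\infty,$$ then there is a set $E\subset[0,+\infty)$ of finite logarithmic $h$-measure, i.e. $\int_{E\cap[1,+\infty)}h(x)\,d\ln x<+\infty$, such that $$F(x+iy)=(1+o(1))\,a_{\nu(x,F)}e^{(x+iy)\lambda_{\nu(x,F)}}$$ as $x\to+\infty$, $x\notin E$, uniformly in $y\in\mathbb{R}$.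
   Context: $\mathcal{L}$ is the class of positive continuous increasing functions on $[0,+\infty)$, and $\mathcal{L}_+$ is the subclass of those $\Phi\in\mathcal{L}$ with $\Phi(t)\to+\infty$ as $t\to+\infty$. For $\Phi\in\mathcal{L}$, $\varphi$ denotes the inverse function of $\Phi$, defined on the range of $\Phi$; by convention $\varphi(t)=0$ for $0\le t<\Phi(0)$, and the displayed condition involving $\varphi(\lambda_n)$ is understood to include that $\varphi(\lambda_n)$ is defined, i.e. $\lambda_n<\sup\Phi$, for $n\ge n_0$. $\mathcal{D}$ is the class of entire Dirichlet series $F(z)=\sum_{n=0}^{+\infty}a_ne^{z\lambda_n}$, absolutely convergent for every $z\in\mathbb{C}$, where $(\lambda_n)$ is a sequence of real numbers with $\lambda_n\ne\lambda_k$ for $n\ne k$ and $0\le\lambda_n<\beta:=\sup\{\lambda_j: j\ge 0\}\le+\infty$ for all $n\ge0$ (the sequence $(\lambda_n)$ may depend on $F$ and is not assumed monotone). For $F\in\mathcal{D}$ and $x\in\mathbb{R}$: $\mu(x,F)=\max\{|a_n|e^{x\lambda_n}: n\ge0\}$ is the maximal term and $\nu(x,F)=\max\{n: |a_n|e^{x\lambda_n}=\mu(x,F)\}$ is the central index. For a fixed sequence $a=(|a_n|)$ with $|a_n|\searrow 0$ ($n_0\le n\to+\infty$), $\mathcal{D}_a$ is the class of all $F\in\mathcal{D}$ whose coefficients have these moduli $|a_n|$. For $\Phi\in\mathcal{L}$, $\mathcal{D}_a(\Phi)$ is the class of $F\in\mathcal{D}_a$ for which there is $x_0$ such that $\ln\mu(x,F)\ge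 x\Phi(x)$ for all $x\ge x_0$. *)

(* Defs.v *)
From HB Require Import structures.
From mathcomp Require Import all_boot all_order all_algebra.
From mathcomp Require Import all_classical all_reals all_analysis.
From mathcomp Require Import complex.

Set Implicit Arguments.
Unset Strict Implicit.
Unset Printing Implicit Defensive.

Import Order.TTheory GRing.Theory Num.Theory.
Import numFieldNormedType.Exports.

Local Open Scope classical_set_scope.
Local Open Scope ring_scope.

(* e^(x + iy) = e^x (cos y + i sin y) *)
Definition cexp (R : realType) (z : R[i]) : R[i] :=
  (expR (complex.Re z))%:C%C
  * (cos (complex.Im z) +i* sin (complex.Im z))%C.

(* The modulus as a real number: the generic norm on R[i] has values in R[i]. *)
Definition modulus (R : realType) (z : R[i]) : R := Normc.normc z.

(* The greatest element of A, with x0 as a dummy value if there is none. *)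
Definition maximum (d : Order.disp_t) (T : porderType d) (x0 : T)
  (A : set T) : T := xget x0 (A `&` ubound A).

(* Functions on [0, +oo) are represented by total functions whose values at
   negative arguments are never constrained nor used.  "Increasing" is strict,
   so that the elements of the class are invertible. *)
Definition classL (R : realType) (f : R -> R) : Prop :=
  [/\ forall t, 0 <= t -> 0 < f t,
      {within `[0, +oo[, continuous f} &
      forall s t, 0 <= s -> s < t -> f s < f t].

Definition classLplus (R : realType) (f : R -> R) : Prop :=
  classL f /\ (f t @[t --> +oo] --> +oo).

(* supremum of f over [0, +oo) *)
Definition supL (R : realType) (f : R -> R) : \bar R :=
  ereal_sup [set (f t)%:E | t in `[0, +oo[].

(* The inverse of f : [0, +oo) -> R.  Outside the range of f the value is 0;
   for f in classL this includes the convention that the inverse vanishes on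
   [0, f 0). *)
Definition inverseL (R : realType) (f : R -> R) (s : R) : R :=
  xget 0 [set t | 0 <= t /\ f t = s].

(* The class D: a Dirichlet series, given by its coefficients a_n and its
   exponents lambda_n, absolutely convergent at every z. *)
Record dirichlet (R : realType) := Dirichlet {
  coef : nat -> R[i];
  expo : nat -> R;
  expo_inj : injective expo;
  expo_ge0 : forall n, 0 <= expo n;
  expo_lt_sup : forall n,
    ((expo n)%:E < ereal_sup (range (fun j => (expo j)%:E)))%E;
  abs_cvg : forall z : R[i],
    cvgn (series (fun n => modulus (coef n * cexp (z * (expo n)%:C%C))))
}.

Definition dterm (R : realType) (F : dirichlet R) (n : nat) (z : R[i]) : R[i] :=
  coef F n * cexp (z * (expo F n)%:C%C).

(* The limit is taken for the norm topology of C, obtained by viewing R[i] as a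
   numFieldType; it exists by abs_cvg. *)
Definition dsum (R : realType) (F : dirichlet R) (z : R[i]) : R[i] :=
  limn (series (fun n => dterm F n z : (R[i] : numFieldType))).

Definition real_term (R : realType) (F : dirichlet R) (x : R) (n : nat) : R :=
  modulus (coef F n) * expR (x * expo F n).

Definition max_term (R : realType) (F : dirichlet R) (x : R) : R :=
  maximum 0 (range (real_term F x)).

Definition central_index (R : realType) (F : dirichlet R) (x : R) : nat :=
  maximum 0%N [set n | real_term F x n = max_term F x].

Definition classDa (R : realType) (a : nat -> R) (F : dirichlet R) : Prop :=
  forall n, modulus (coef F n) = a n.

Definition classDaPhi (R : realType) (a : nat -> R) (Phi : R -> R)
    (F : dirichlet R) : Prop :=
  classDa a F /\
  exists x0, forall x, x0 <= x -> x * Phi x <= ln (max_term F x).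

(* d ln x = dx / x *)
Definition finite_log_measure (R : realType) (h : R -> R) (E : set R) : Prop :=
  (\int[lebesgue_measure]_(x in E `&` `[1%R, +oo[) (h x / x)%:E < +oo)%E.

(* G (x + iy) = (1 + o(1)) H (x + iy) as x --> +oo, x \notin E, uniformly in y *)
Definition unif_equiv_off (R : realType) (E : set R) (G H : R -> R -> R[i]) :
    Prop :=
  exists o : R -> R -> R[i],
    (\forall x \near +oo, ~ E x -> forall y, G x y = (1 + o x y) * H x y) /\
    (forall e : R, 0 < e ->
      \forall x \near +oo, ~ E x -> forall y, modulus (o x y) <= e).

(* Main.v *)
(* With [t_n = |a_n| e^(x lambda_n)] one has [ln mu(x) / x = max_n (lambda_n - mu_n / x)],
   so the [mu_n], increasing for [n >= n0], act as exponents and [1 / x] as the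
   variable.  Let [s_j] be the slope, over [[mu_j, mu_(j+1)]], of the concave
   majorant of the points [(mu_n, lambda_n)], and [d_j = mu_(j+1) - mu_j]; then
   [x s_j <= 1] for [j >= nu(x)] and [x s_j >= 1] for [j < nu(x)].  Fix [C > 0]
   and call [x] exceptional if [|x s_j - 1| < C / d_j] for some record [j], i.e.
   some [j] with [lambda_j] larger than the preceding exponents.  For the other
   [x] the quotients [t_n / mu(x)] decay by a factor [e^(-C)] at each record, and
   between two records by [a_(n+1) / a_n <= e^(-C)] (after replacing [lambda_n] by
   its running maximum), so the noncentral terms sum to at most
   [10 e^(-C) mu(x)].  Since [ln mu(x) >= x Phi(x)], [1 / s_j <= phi(lambda_j)]
   for a record [j], hence the exceptional set has logarithmic [h]-measure at most
   [4 C sum_j h(phi(lambda_j) (1 + C / d_j)) / d_j].  Letting [C] tend to infinity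
   along the integers, with [j] starting far enough each time, gives the result. *)
Require Import Defs.
From HB Require Import structures.
From mathcomp Require Import all_boot all_order all_algebra.
From mathcomp Require Import all_classical all_reals all_analysis.
From mathcomp Require Import measurable_realfun complex.
From mathcomp Require Import ring lra.
Import Order.TTheory GRing.Theory Num.Theory.
Import numFieldNormedType.Exports.
Local Open Scope classical_set_scope.
Local Open Scope ring_scope.

Set Implicit Arguments.
Unset Strict Implicit.
Unset Printing Implicit Defensive.

(** * Geometric bounds for sums on either side of a central index *)

(** The potential [4 * p n + 2 * q * T n], where [p n] bounds [g n.+1], pays for all later terms:
    where [r] holds, the new term is at most [p n] and [p] is at least halved; elsewhere [T] shrinks
    by [q], and [2 * q <= 1]. *)
Lemma sum_after_le (R : realFieldType) (q : R) (r : nat -> bool)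
    (T g : nat -> R) (n : nat) :
  0 <= q -> q <= 2^-1 ->
  (forall i, 0 <= T i) -> (forall i, 0 <= g i) ->
  (forall i, r i -> T i <= g i) ->
  (forall i, ~~ r i.+1 -> T i.+1 <= q * T i) ->
  (forall i, g i.+1 <= g i) -> (forall i, r i -> g i.+1 <= q * g i) ->
  r 0%N -> g 0%N <= 1 ->
  \sum_(0 <= i < n) T i.+1 <= 6 * q.
Proof.
move=> q0 q2 T0 g0 Tg Tq gd gq r0 g01.
pose p i := if r i then q * g i else g i.
have gp i : g i.+1 <= p i by rewrite /p; case: ifP => // /gq.
have p0 i : 0 <= p i by rewrite /p; case: ifP => // _; rewrite mulr_ge0.
suff: \sum_(0 <= i < n) T i.+1 + 4 * p n + 2 * q * T n <= 6 * q.
  have := mulr_ge0 q0 (T0 n); have := p0 n; lra.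
elim: n => [|n IHn].
  rewrite big_geq// /p r0; have := Tg _ r0.
  have := ler_wpM2l q0 (Tg _ r0); have := ler_wpM2l q0 g01; lra.
rewrite big_nat_recr//=; have := gp n; have := p0 n; have := mulr_ge0 q0 (T0 n).
have [rn|rn] := boolP (r n.+1).
  have -> : p n.+1 = q * g n.+1 by rewrite /p rn.
  have := Tg _ rn => Tgn qT0 p0n gpn.
  have : T n.+1 <= p n by exact: le_trans gpn.
  have := g0 n.+1; have := T0 n.+1 => *; nra.
have -> : p n.+1 = g n.+1 by rewrite /p (negbTE rn).
move=> qT0 p0n gpn.
have := Tq _ rn; have := T0 n.+1; have := T0 n; move=> *; nra.
Qed.

(** Mirror image, with [g] nondecreasing up to [n]. The partial sum stays below
    [4 * q * g k.+1 - 2 * q * T k]; the amount [2 * q * T k] held back absorbs the next term when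
    [r k.+1] fails. *)
Lemma sum_before_le (R : realFieldType) (q : R) (r : nat -> bool)
    (T g : nat -> R) (n : nat) :
  0 <= q -> q <= 2^-1 ->
  (forall i, 0 <= T i) -> (forall i, 0 <= g i) ->
  (forall i, r i -> T i <= g i) ->
  (forall i, ~~ r i.+1 -> T i.+1 <= q * T i) ->
  (forall i, (i < n)%N -> g i <= g i.+1) ->
  (forall i, (i < n)%N -> r i -> g i <= q * g i.+1) ->
  r 0%N -> g n <= 1 ->
  \sum_(0 <= i < n) T i <= 4 * q.
Proof.
move=> q0 q2 T0 g0 Tg Tq gi gq r0 gn.
case: n => [|n] in gi gq gn *; first by rewrite big_geq// mulr_ge0.
suff H k : (k <= n)%N ->
    \sum_(0 <= i < k.+1) T i <= 4 * q * g k.+1 - 2 * q * T k.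
  have := H n (leqnn _); have := mulr_ge0 q0 (T0 n).
  have := ler_wpM2l q0 gn; lra.
elim: k => [|k IHk] kn.
  rewrite big_nat1; have := gq 0%N (ltn0Sn _) r0; have := Tg _ r0.
  have := ler_wpM2r (T0 0%N) q2; have := mulr_ge0 q0 (g0 1%N); lra.
have IH := IHk (ltnW kn).
rewrite big_nat_recr//=; set S := \sum_(_ <= _ < _) _ in IH *.
have gk : g k.+1 <= g k.+2 by apply: gi; rewrite ltnS.
have [rk|rk] := boolP (r k.+1).
  have := gq k.+1; rewrite ltnS => /(_ kn rk); have := Tg _ rk.
  have := ler_wpM2r (T0 k.+1) q2; have := ler_wpM2r (g0 k.+1) q2.
  have := mulr_ge0 q0 (T0 k); lra.
have := Tq _ rk; have := T0 k.+1; have := T0 k.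
have := ler_wpM2l q0 gk; have := ler_wpM2r (mulr_ge0 q0 (T0 k)) q2.
have := ler_wpM2l q0 (Tq _ rk); lra.
Qed.

(** * Running maxima of the exponents and the noncentral terms *)

Fixpoint running_max (R : realDomainType) (l : nat -> R) (n : nat) : R :=
  if n is k.+1 then Num.max (running_max l k) (l n) else l 0%N.

Definition is_record (R : realDomainType) (l : nat -> R) (n : nat) : bool :=
  running_max l n == l n.

Lemma running_max_ge (R : realDomainType) (l : nat -> R) (i n : nat) :
  (i <= n)%N -> l i <= running_max l n.
Proof.
elim: n => [|n IHn]; first by rewrite leqn0 => /eqP ->.
by rewrite leq_eqVlt ltnS => /predU1P[-> |/IHn] /=; rewrite le_max ?lexx ?orbT// => ->.
Qed.

Lemma running_max_le (R : realDomainType) (l : nat -> R) (n : nat) (y : R) :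
  (forall i, (i <= n)%N -> l i <= y) -> running_max l n <= y.
Proof.
elim: n => [|n IHn] ly /=; first exact: ly.
by rewrite ge_max ly// IHn// => i /leqW; exact: ly.
Qed.

Lemma sum_neq_le (R : realFieldType) (f : nat -> R) (v n : nat) :
  (forall i, 0 <= f i) ->
  \sum_(0 <= i < n | i != v) f i
    <= \sum_(0 <= i < v) f i + \sum_(0 <= i < n) f (v + i.+1)%N.
Proof.
move=> f0; apply: (@le_trans _ _ (\sum_(0 <= i < v.+1 + n | i != v) f i)).
  rewrite (@big_cat_nat _ _ _ n 0%N (v.+1 + n)%N)//= ?leq_addl// lerDl.
  exact: sumr_ge0.
rewrite (@big_cat_nat _ _ _ v.+1 0%N (v.+1 + n)%N)//= ?leq_addr//.
rewrite big_mkcond big_nat_recr//= eqxx addr0 -big_mkcond lerD//.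
  by rewrite [leLHS]big_mkcond/=; apply: ler_sum => i _; case: ifP.
rewrite -{1}[v.+1]add0n big_addn addKn big_mkcond.
apply: ler_sum => i _; case: ifP => // _.
by rewrite -addSnnS addnC.
Qed.

(* [c] plays the role of the concave majorant of the points [(m n, l n)], and
   [(c j.+1 - c j) / (m j.+1 - m j)] of its slopes. *)
Lemma nonmaximal_terms_le (R : realType) (l m c : nat -> R) (x M C : R)
    (v n : nat) :
  0 < x -> expR (- C) <= 2^-1 ->
  (forall i, C <= m i.+1 - m i) -> (forall i, m i <= m i.+1) ->
  (forall i, x * l i - m i <= M) -> x * l v - m v = M ->
  c v = l v -> (forall i, l i <= c i) ->
  (forall j, (v <= j)%N -> x * (c j.+1 - c j) <= m j.+1 - m j) ->
  (forall j, (j < v)%N -> m j.+1 - m j <= x * (c j.+1 - c j)) ->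
  (forall j, is_record l j -> C <= `|x * (c j.+1 - c j) - (m j.+1 - m j)|) ->
  \sum_(0 <= i < n | i != v) expR (x * l i - m i - M) <= 10 * expR (- C).
Proof.
move=> x0 C2 dC md lM lvM cv lc cr cl good.
pose T i := expR (x * running_max l i - m i - M).
pose g i := expR (x * c i - m i - M).
have q0 : 0 <= expR (- C) := expR_ge0 _.
have T0 i : 0 <= T i := expR_ge0 _.
have g0 i : 0 <= g i := expR_ge0 _.
have mono : {homo m : i j / (i <= j)%N >-> i <= j}.
  by apply: homo_leq => [//|? ? ?|//]; exact: le_trans.
(* As [m] is nondecreasing and [x] positive, a larger exponent before [v] would give a term above
   the maximal one. *)
have rec_v : is_record l v.
  rewrite /is_record eq_le running_max_ge// andbT.
  apply: running_max_le => i /mono iv.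
  rewrite -(ler_pM2l x0); have := lM i; rewrite -lvM; lra.
have Tg i : is_record l i -> T i <= g i.
  move=> /eqP ri; rewrite /T /g ler_expR ri !lerD2r ler_pM2l//.
have Tq i : ~~ is_record l i.+1 -> T i.+1 <= expR (- C) * T i.
  rewrite /is_record /= /T -expRD ler_expR /=.
  case: (leP (running_max l i) (l i.+1)) => [_|_ _]; first by rewrite eqxx.
  have := dC i; lra.
apply: (@le_trans _ _ (\sum_(0 <= i < n | i != v) T i)).
  by apply: ler_sum => i _; rewrite ler_expR !lerD2r ler_pM2l// running_max_ge.
apply: (le_trans (sum_neq_le v n (fun i => expR_ge0 _))).
have -> : (10 : R) = 4 + 6 by lra.
have gv : g v <= 1 by rewrite /g cv lvM subrr expR0.
rewrite mulrDl lerD//.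
  (* Left of [v] the quantity inside the absolute value in [good] is nonnegative, so after a record
     [g] grows by a factor of at least [expR C]; right of [v] it is nonpositive and [g] falls by at
     least that factor. *)
  apply: (@sum_before_le _ _ (is_record l) T g) => // [i iv|i iv ri|].
  - by rewrite ler_expR; have := cl _ iv; lra.
  - rewrite -expRD ler_expR; have := good _ ri; have := cl _ iv => h.
    by rewrite ger0_norm; lra.
  - exact: eqxx.
apply: (@sum_after_le _ _ (fun i => is_record l (v + i)%N)
   (fun i => T (v + i)%N) (fun i => g (v + i)%N)) => //=.
- by move=> i; exact: Tg.
- by move=> i; rewrite addnS; exact: Tq.
- by move=> i; rewrite addnS ler_expR; have := cr _ (leq_addr i v); lra.
- move=> i ri; rewrite addnS -expRD ler_expR.
  have := good _ ri; have := cr _ (leq_addr i v) => h.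
  by rewrite ler0_norm; lra.
- by rewrite addn0.
- by rewrite addn0.
Qed.

(** * The concave majorant and its slopes *)

(* The infimum of the affine functions [t |-> (M y + t) / y] at [t = m j]; it is
   attained at [y] when [M y] is the logarithm of a term with index [j]. *)
Definition hull (R : realType) (X : R) (M : R -> R) (m : nat -> R) (j : nat) : R :=
  inf [set (M y + m j) / y | y in [set y | X <= y]].

Lemma hull_ge (R : realType) (X : R) (M : R -> R) (m : nat -> R) (j : nat)
    (t : R) :
  (forall y, X <= y -> t <= (M y + m j) / y) -> t <= hull X M m j.
Proof.
move=> tM; apply: lb_le_inf; first by exists ((M X + m j) / X), X => //=.
by move=> _ [y /= Xy <-]; exact: tM.
Qed.

Lemma hull_le (R : realType) (X : R) (M : R -> R) (m l : nat -> R) (j : nat) :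
  0 < X -> (forall y i, X <= y -> y * l i - m i <= M y) ->
  forall y, X <= y -> hull X M m j <= (M y + m j) / y.
Proof.
move=> X0 lM y Xy; apply: ge_inf; last by exists y.
exists (l j) => _ [z /= Xz <-]; have z0 := lt_le_trans X0 Xz.
by rewrite ler_pdivlMr//; have := lM z j Xz; lra.
Qed.

Lemma le_hull (R : realType) (X : R) (M : R -> R) (m l : nat -> R) (j : nat) :
  0 < X -> (forall y i, X <= y -> y * l i - m i <= M y) -> l j <= hull X M m j.
Proof.
move=> X0 lM; apply: hull_ge => y Xy; have y0 := lt_le_trans X0 Xy.
by rewrite ler_pdivlMr//; have := lM y j Xy; lra.
Qed.

Lemma hull_eq (R : realType) (X : R) (M : R -> R) (m l : nat -> R) (x : R)
    (v : nat) :
  0 < X -> (forall y i, X <= y -> y * l i - m i <= M y) ->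
  X <= x -> x * l v - m v = M x -> hull X M m v = l v.
Proof.
move=> X0 lM Xx xM; apply/le_anti; rewrite (le_hull _ X0 lM) andbT.
have x0 := lt_le_trans X0 Xx.
apply: (le_trans (hull_le _ X0 lM Xx)).
by rewrite -xM ler_pdivrMr//; lra.
Qed.

(** The affine function for [y] has slope [1 / y], and the one for [x] passes through [(m v, l v)].
    Right of [m v], those with [y >= x] have slope at most [1 / x], while those with [y < x] lie
    above the one for [x]: at [m v] they are at least [l v], and they are steeper. *)
Lemma hull_slope_le (R : realType) (X : R) (M : R -> R) (m l : nat -> R) (x : R)
    (v j : nat) :
  0 < X -> {homo m : i k / (i <= k)%N >-> i <= k} ->
  (forall y i, X <= y -> y * l i - m i <= M y) ->
  X <= x -> x * l v - m v = M x -> (v <= j)%N ->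
  x * (hull X M m j.+1 - hull X M m j) <= m j.+1 - m j.
Proof.
move=> X0 mono lM Xx xM vj; have x0 := lt_le_trans X0 Xx.
rewrite mulrC -ler_pdivlMr// lerBlDr addrC -lerBlDr; apply: hull_ge => y Xy.
have y0 := lt_le_trans X0 Xy.
rewrite lerBlDr.
have mj : 0 <= m j.+1 - m j by rewrite subr_ge0 mono.
have mv : 0 <= m j - m v by rewrite subr_ge0 mono.
have hl := hull_le j.+1 X0 lM.
have [xy|yx] := leP x y.
  apply: (le_trans (hl _ Xy)).
  have -> : (M y + m j.+1) / y = (M y + m j) / y + (m j.+1 - m j) / y by field; lra.
  by rewrite lerD2l ler_wpM2l// lef_pV2.
apply: (le_trans (hl _ Xx)).
have -> : (M x + m j.+1) / x = l v + (m j - m v) / x + (m j.+1 - m j) / x.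
  by rewrite -xM; field; lra.
rewrite lerD2r (@le_trans _ _ (l v + (m j - m v) / y))//.
  by rewrite lerD2l ler_wpM2l// lef_pV2// ltW.
by rewrite ler_pdivlMr// mulrDl divfK ?gt_eqF//; have := lM y v Xy; lra.
Qed.

(** Symmetric: left of [m v], those with [y <= x] have slope at least [1 / x], and those with
    [y > x] lie above the one for [x]. *)
Lemma hull_slope_ge (R : realType) (X : R) (M : R -> R) (m l : nat -> R) (x : R)
    (v j : nat) :
  0 < X -> {homo m : i k / (i <= k)%N >-> i <= k} ->
  (forall y i, X <= y -> y * l i - m i <= M y) ->
  X <= x -> x * l v - m v = M x -> (j < v)%N ->
  m j.+1 - m j <= x * (hull X M m j.+1 - hull X M m j).
Proof.
move=> X0 mono lM Xx xM vj; have x0 := lt_le_trans X0 Xx.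
rewrite mulrC -ler_pdivrMr// lerBrDr; apply: hull_ge => y Xy.
have y0 := lt_le_trans X0 Xy.
have mj : 0 <= m j.+1 - m j by rewrite subr_ge0 mono.
have mv : 0 <= m v - m j.+1 by rewrite subr_ge0 mono.
have hl := hull_le j X0 lM.
have [yx|xy] := leP y x.
  apply: (@le_trans _ _ ((m j.+1 - m j) / y + (M y + m j) / y)); last first.
    by rewrite -mulrDl ler_pM2r ?invr_gt0//; lra.
  by rewrite lerD ?hl// ler_wpM2l// lef_pV2.
apply: (@le_trans _ _ ((m j.+1 - m j) / x + (M x + m j) / x)).
  by rewrite lerD2l hl.
have -> : (m j.+1 - m j) / x + (M x + m j) / x = l v - (m v - m j.+1) / x.
  by rewrite -xM; field; lra.
rewrite (@le_trans _ _ (l v - (m v - m j.+1) / y))//.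
  by rewrite lerD2l lerN2 ler_wpM2l// lef_pV2// ltW.
by rewrite ler_pdivlMr// mulrBl divfK ?gt_eqF//; have := lM y v Xy; lra.
Qed.

(** * The inverse function, and integrals against [dx / x] *)

Lemma inverseL_ge0 (R : realType) (f : R -> R) (s : R) : 0 <= inverseL f s.
Proof. by rewrite /inverseL; case: xgetP => [y _ []|]. Qed.

(** Below the supremum, the intermediate value theorem puts [s] in the range of [f], so
    [inverseL f s] is a true preimage rather than the default [0]; monotonicity then compares it
    with [y]. *)
Lemma le_inverseL (R : realType) (f : R -> R) (s y : R) :
  classL f -> (s%:E < supL f)%E -> 0 <= y -> f y <= s -> y <= inverseL f s.
Proof.
move=> [_ cf incf] /ereal_sup_gt[_ [u + <-]] + y0 fys.
rewrite /= in_itv/= andbT lte_fin => u0 su.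
have yu : y <= u.
  rewrite leNgt; apply/negP => uy.
  by have := incf _ _ u0 uy; rewrite ltNge (le_trans fys)// ltW.
have [t] : exists2 t, t \in `[y, u] & f t = s.
  apply: IVT => //; last by rewrite ge_min fys/= le_max (ltW su) orbT.
  apply: continuous_subspaceW cf => t /=; rewrite !in_itv/= andbT.
  by move=> /andP[+ _]; exact: le_trans.
rewrite in_itv/= => /andP[yt _] fts.
have [|i0 fi] := @xgetPex _ 0 [set t | 0 <= t /\ f t = s].
  by exists t; split => //; exact: le_trans yt.
rewrite leNgt; apply/negP => iy.
by have := incf _ _ i0 iy; rewrite /= fi ltNge fys.
Qed.

(** The integral is additive over the disjoint pieces [seqDU F], each contained in the corresponding
    [F k]. *)
Lemma ge0_integral_bigcup_le d (T : measurableType d) (R : realType)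
    (mu : {measure set T -> \bar R}) (F : nat -> set T) (f : T -> \bar R) :
  (forall k, measurable (F k)) -> measurable_fun (\bigcup_k F k) f ->
  (forall x, (\bigcup_k F k) x -> (0 <= f x)%E) ->
  (\int[mu]_(x in \bigcup_k F k) f x
    <= \sum_(0 <= i <oo) \int[mu]_(x in F i) f x)%E.
Proof.
move=> mF mf f0.
have mD k : measurable (seqDU F k).
  by apply: measurableD => //; exact: bigsetU_measurable.
have sub k : F k `<=` \bigcup_k F k by move=> x Fx; exists k.
have subD k : seqDU F k `<=` F k by move=> x [].
rewrite seqDU_bigcup_eq ge0_integral_bigcup//; rewrite -?seqDU_bigcup_eq//.
apply: lee_nneseries => [i _ _|i _].
  by apply: integral_ge0 => x /subD/sub; exact: f0.
apply: ge0_subset_integral => //.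
- by apply: measurable_funS mf => //; exact: bigcup_measurable.
- by move=> x /sub; exact: f0.
Qed.

Lemma classL_measurable_div (R : realType) (h : R -> R) :
  classL h -> measurable_fun (`[1, +oo[%classic : set R) (fun x => (h x / x)%:E).
Proof.
move=> [_ ch _]; apply/measurable_EFinP.
apply: measurable_funM.
  apply: subspace_continuous_measurable_fun => //.
  apply: continuous_subspaceW ch => t /=; rewrite !in_itv/= !andbT.
  exact: le_trans.
apply: subspace_continuous_measurable_fun => //.
apply: continuous_in_subspaceT => t; rewrite inE/= in_itv/= andbT => t1.
by apply: inv_continuous; rewrite gt_eqF// (lt_le_trans ltr01).
Qed.

(** As [e <= 2^-1], one has [x >= z / 2] on [B], so the integrand is at most [2 * H / z], while the
    ball has measure [2 * z * e]. *)
Lemma integral_ball_div_le (R : realType) (h : R -> R) (B : set R) (z e H : R) :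
  classL h -> measurable B -> B `<=` `[1, +oo[ ->
  (forall x, B x -> `|x - z| < z * e) -> 0 < z -> 0 <= e -> e <= 2^-1 ->
  (forall x, B x -> h x <= H) -> 0 <= H ->
  (\int[lebesgue_measure]_(x in B) (h x / x)%:E <= (4 * (H * e))%:E)%E.
Proof.
move=> hL mB B1 Bz z0 e0 e2 BH H0.
have mh := measurable_funS (measurable_itv _) B1 (classL_measurable_div hL).
apply: (@le_trans _ _ (\int[lebesgue_measure]_(x in B) (2 * H / z)%:E)%E).
  apply: ge0_le_integral => // x Bx.
    have := B1 _ Bx; rewrite /= in_itv/= andbT => x1.
    rewrite lee_fin divr_ge0//; last lra.
    by case: hL => + _ _ => /(_ x) h0; apply/ltW/h0; lra.
  have := B1 _ Bx; rewrite /= in_itv/= andbT => x1.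
  have := Bz _ Bx; rewrite ltr_norml => /andP[xz _].
  have zx : z / 2 <= x by have := ler_wpM2l (ltW z0) e2; lra.
  rewrite lee_fin ler_pdivrMr; last lra.
  apply: (le_trans (BH _ Bx)).
  have -> : 2 * H / z * x = H * (x * 2 / z) by field; lra.
  by rewrite ler_peMr// ler_pdivlMr//; lra.
rewrite integral_cst//.
have -> : 4 * (H * e) = (2 * H / z) * ((z * e) *+ 2) by field; lra.
rewrite [leRHS]EFinM lee_wpmul2l//.
  by rewrite lee_fin divr_ge0// ?mulr_ge0// ltW.
rewrite -(lebesgue_measure_ball z); last by rewrite mulr_ge0// ltW.
apply: le_measure; rewrite ?inE//.
  exact: measurable_ball.
by move=> x Bx; rewrite /ball/= distrC Bz.
Qed.

(** * Modulus, maximal term and sum of a Dirichlet series *)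

Lemma normc_ge_Re_Im (R : rcfType) (z : R[i]) :
  `|complex.Re z| <= Normc.normc z /\ `|complex.Im z| <= Normc.normc z.
Proof.
case: z => a b /=; rewrite -(sqrtr_sqr a) -(sqrtr_sqr b).
by split; rewrite ler_sqrt ?addr_ge0 ?sqr_ge0// ?lerDl ?lerDr sqr_ge0.
Qed.

Lemma normc_le_Re_Im (R : rcfType) (z : R[i]) :
  Normc.normc z <= `|complex.Re z| + `|complex.Im z|.
Proof.
case: z => a b /=; rewrite -[leRHS]ger0_norm ?addr_ge0//.
rewrite -(sqrtr_sqr (`|a| + `|b|)) ler_sqrt ?sqr_ge0// sqrrD !real_normK ?num_real//.
by rewrite lerD2r lerDl mulrn_wge0// mulr_ge0.
Qed.

Lemma modulus_ge0 (R : realType) (z : R[i]) : 0 <= modulus z.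
Proof. by case: z => a b; exact: sqrtr_ge0. Qed.

Lemma modulus_cexp (R : realType) (z : R[i]) :
  modulus (cexp z) = expR (complex.Re z).
Proof.
rewrite /modulus /cexp Normc.normcM /= expr0n addr0 cos2Dsin2 sqrtr1 mulr1.
by rewrite sqrtr_sqr ger0_norm ?expR_ge0.
Qed.

Lemma modulus_dterm (R : realType) (F : dirichlet R) (n : nat) (x y : R) :
  modulus (dterm F n (x +i* y)%C) = real_term F x n.
Proof.
rewrite /dterm /real_term /modulus Normc.normcM -!/(modulus _) modulus_cexp /=.
by rewrite mulr0 subr0.
Qed.

Lemma real_term_ge0 (R : realType) (F : dirichlet R) (x : R) (n : nat) :
  0 <= real_term F x n.
Proof. by rewrite mulr_ge0 ?modulus_ge0 ?expR_ge0. Qed.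

Lemma cvg_series_real_term (R : realType) (F : dirichlet R) (x : R) :
  cvgn (series (real_term F x)).
Proof.
have := @abs_cvg R F (x +i* 0)%C.
by under eq_fun do rewrite -/(dterm F _ _) modulus_dterm.
Qed.

(** Terms beyond some [N] are below [u k], so the maximum over the first [N] terms is global, and
    only finitely many indices attain it. *)
Lemma last_argmax (R : realType) (u : nat -> R) (k : nat) :
  u n @[n --> \oo] --> (0 : R) -> 0 < u k ->
  exists v, (forall n, u n <= u v) /\ (forall n, u n = u v -> (n <= v)%N).
Proof.
move=> u0 uk.
have [N _ uN] : \forall n \near \oo, u n < u k by exact: cvgr_lt u0 _ uk.
have kN : (k < N)%N by rewrite ltnNge; apply/negP => /uN /=; rewrite ltxx.
pose i := [arg max_(j > Ordinal kN) u j]%O.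
have ui n : u n <= u i.
  rewrite /i; case: arg_maxP => //= j _ uj.
  have [/uN/= unk|nN] := leqP N n; last exact: (uj (Ordinal nN)).
  by rewrite (le_trans (ltW unk))// (uj (Ordinal kN)).
have exP : exists n, u n == u i by exists i.
have bd n : u n == u i -> (n <= N)%N.
  move=> /eqP un; rewrite leqNgt; apply/negP => /ltnW /uN /=.
  by rewrite un ltNge ui.
case: (ex_maxnP exP bd) => v /eqP uv vmax.
by exists v; split => n; rewrite uv// => /eqP; exact: vmax.
Qed.

Lemma maximum_unique (d : Order.disp_t) (T : porderType d) (x0 x : T)
  (A : set T) : A x -> ubound A x -> maximum x0 A = x.
Proof.
move=> Ax ubx; apply: xget_unique => // y [Ay uby].
by apply/le_anti; rewrite ubx// uby.
Qed.

(** A nonzero coefficient makes both maxima exist, so that neither is a dummy value. *)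
Lemma central_indexP (R : realType) (F : dirichlet R) (x : R) (k : nat) :
  0 < modulus (coef F k) ->
  real_term F x (central_index F x) = max_term F x /\
  (forall n, real_term F x n <= max_term F x).
Proof.
move=> ak.
have [|v [maxv lastv]] := @last_argmax _ (real_term F x) k
  (cvg_series_cvg_0 (@cvg_series_real_term _ F x)).
  by rewrite mulr_gt0 ?expR_gt0.
have E : max_term F x = real_term F x v.
  by apply: maximum_unique => [|_ [n _ <-]]; [exists v | exact: maxv].
suff -> : central_index F x = v by rewrite E.
by apply: maximum_unique => [|n /=]; rewrite E//; exact: lastv.
Qed.

Lemma cvgn_complex (R : realType) (u : nat -> R[i]) (l : R[i]) :
  (modulus (l - u n) @[n --> \oo] --> (0 : R)) ->
  (u : nat -> (R[i] : numFieldType)) @ \oo --> (l : (R[i] : numFieldType)).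
Proof.
(* A positive radius in [R[i]] has imaginary part [0]. *)
move=> ul; apply/cvgrPdist_lt => -[e e'] /=; rewrite ltcE/= => /andP[/eqP-> e0].
near=> n; rewrite normc_def ltcR.
have : modulus (l - u n) < e by near: n; exact: cvgr_lt ul _ e0.
by rewrite /modulus; case: (l - u n).
Unshelve. all: by end_near. Qed.

Lemma cvgn_abs_series (R : realType) (u v : nat -> R) :
  (forall n, `|u n| <= v n) -> cvgn (series v) -> cvgn (series u).
Proof.
move=> uv cv; apply: normed_cvg; apply: series_le_cvg cv => n //=.
exact: le_trans (uv n).
Qed.

(** The real and imaginary parts converge absolutely and give the limit [L]; splitting [L - t v] at
    a partial sum leaves the other terms and a remainder tending to [0]. *)
Lemma dsum_approx (R : realType) (F : dirichlet R) (x y e : R) (v : nat) :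
  (forall n, \sum_(0 <= i < n | i != v) real_term F x i <= e) ->
  modulus (dsum F (x +i* y)%C - dterm F v (x +i* y)%C) <= e.
Proof.
move=> sum_le; set z := (x +i* y)%C; pose t n := dterm F n z.
have tE n : modulus (t n) = real_term F x n by exact: modulus_dterm.
have cRe : cvgn (series (fun n => complex.Re (t n))).
  apply: cvgn_abs_series (@cvg_series_real_term _ F x) => n.
  by rewrite -tE; case: (normc_ge_Re_Im (t n)).
have cIm : cvgn (series (fun n => complex.Im (t n))).
  apply: cvgn_abs_series (@cvg_series_real_term _ F x) => n.
  by rewrite -tE; case: (normc_ge_Re_Im (t n)).
set r := limn _ in cRe; set s := limn _ in cIm.
pose S : nat -> R[i] := series (t : nat -> (R[i] : numFieldType)).
have ReS n : complex.Re (S n) = series (fun n => complex.Re (t n)) n.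
  by rewrite /S !seriesEnat/= raddf_sum.
have ImS n : complex.Im (S n) = series (fun n => complex.Im (t n)) n.
  by rewrite /S !seriesEnat/= raddf_sum.
pose L := (r +i* s)%C.
have SL : modulus (L - S n) @[n --> \oo] --> (0 : R).
  have h : `|r - complex.Re (S n)| + `|s - complex.Im (S n)| @[n --> \oo]
      --> (0 : R).
    rewrite -[X in _ --> X]addr0; apply: cvgD.
      rewrite -[X in _ --> X](@normr0 _ R) -(subrr r); apply: cvg_norm.
      apply: cvgB; first exact: cvg_cst.
      by under eq_fun do rewrite ReS.
    rewrite -[X in _ --> X](@normr0 _ R) -(subrr s); apply: cvg_norm.
    apply: cvgB; first exact: cvg_cst.
    by under eq_fun do rewrite ImS.
  apply: (squeeze_cvgr _ (cvg_cst (0 : R)) h); apply: nearW => n.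
  rewrite modulus_ge0/=; apply: le_trans (normc_le_Re_Im _) _.
  by case: (S n).
have -> : dsum F z = L.
  have := cvg_lim (@norm_hausdorff _ _) (cvgn_complex SL); exact.
apply/ler_addgt0Pr => d d0.
have [N _ hN] : \forall n \near \oo, modulus (L - S n) < d.
  exact: cvgr_lt SL _ d0.
(* With [v.+1] the term of index [v] occurs in the partial sum. *)
pose n := maxn N v.+1.
have -> : L - dterm F v z = (S n - t v) + (L - S n).
  by rewrite [RHS]addrC [RHS]addrA subrK.
apply: (le_trans (le_normcD _ _)).
apply: lerD; last by apply/ltW/hN; exact: leq_maxl.
apply: le_trans (sum_le n).
have -> : S n - t v = \sum_(0 <= i < n | i != v) t i.
  rewrite /S seriesEnat/= !big_mkord.
  have vn : (v < n)%N by rewrite leq_max ltnSn orbT.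
  by rewrite (bigD1 (Ordinal vn))//= addrAC subrr add0r.
elim/big_rec2: _ => [|i a b _ ab]; first by rewrite Normc.normc0.
by rewrite (le_trans (le_normcD _ _))// -tE lerD.
Qed.

(** * The exceptional set for a fixed constant [C] *)

Lemma exceptional_set (R : realType) (l m : nat -> R) (M h Phi : R -> R)
    (X C : R) :
  classL h -> classL Phi -> 1 <= X -> 0 < C -> expR (- C) <= 2^-1 ->
  (forall j, 2 * C <= m j.+1 - m j) -> (forall j, 0 <= m j) ->
  (forall y i, X <= y -> y * l i - m i <= M y) ->
  (forall y, X <= y -> exists v, y * l v - m v = M y) ->
  (forall y, X <= y -> y * Phi y <= M y) ->
  (forall j, ((l j)%:E < supL Phi)%E) ->
  exists E : set R, [/\ measurable E, E `<=` `[1, +oo[,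
    (\int[lebesgue_measure]_(x in E) (h x / x)%:E <= \sum_(0 <= j <oo)
      (4 * (h (inverseL Phi (l j) * (1 + C / (m j.+1 - m j)))
            * (C / (m j.+1 - m j))))%:E)%E &
    forall x v n, 2 * X <= x -> ~ E x -> x * l v - m v = M x ->
      \sum_(0 <= i < n | i != v) expR (x * l i - m i - M x) <= 10 * expR (- C)].
Proof.
move=> hL PhiL X1 C0 C2 dC m0 lM lmax PhiM phi_def.
have X0 : 0 < X by lra.
pose d j := m j.+1 - m j.
have d0 j : 0 < d j by have := dC j; rewrite -/(d j); lra.
have mono : {homo m : i j / (i <= j)%N >-> i <= j}.
  apply: homo_leq => [//|? ? ?|j]; first exact: le_trans.
  by have := d0 j; rewrite /d; lra.
(* Here [s j] is the increment of the majorant and [z j] the reciprocal of its slope. For [s j > 0],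
   the condition [|x * s j - d j| < C] becomes [|x - z j| < z j * e j]. *)
pose s j := hull X M m j.+1 - hull X M m j.
pose z j := d j / s j.
pose e j := C / d j.
have e0 j : 0 <= e j by rewrite divr_ge0// ltW.
have e2 j : e j <= 2^-1.
  by rewrite ler_pdivrMr//; have := dC j; rewrite -/(d j); lra.
pose B j : set R :=
  [set x | [/\ is_record l j, 0 < s j, 2 * X <= x & `|x - z j| < z j * e j]].
have B1 j : B j `<=` `[1, +oo[.
  by move=> x [_ _ Xx _]; rewrite /= in_itv/= andbT; lra.
have mB j : measurable (B j).
  have [/andP[r sj]|rs] := boolP (is_record l j && (0 < s j)); last first.
    rewrite (_ : B j = set0)//; apply/seteqP; split => // x [r sj _ _].
    by rewrite r sj in rs.
  rewrite (_ : B j = `[2 * X, +oo[%classic `&` ball (z j) (z j * e j)).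
    by apply: measurableI => //; exact: measurable_ball.
  apply/seteqP; split => x /=; rewrite in_itv/= andbT /ball/= distrC.
    by move=> [].
  by move=> [].
have z_le j x : B j x -> z j <= inverseL Phi (l j).
  move=> [/eqP rj sj Xx xz].
  have zj : 0 < z j by rewrite divr_gt0.
  (* From [e j <= 2^-1] and [2 * X <= x] follows [2 * X < 3 / 2 * z j]; this is the reason for the
     factor [2] in [B j]. *)
  have zX : X < z j.
    have := ler_wpM2l (ltW zj) (e2 j).
    by move: xz; rewrite ltr_norml => /andP[_ +]; lra.
  (* For [y < z j] the slope forces the index [v] maximal at [y] to satisfy [v <= j]. As [j] is a
     record and [m v >= 0], this gives [y * Phi y <= M y <= y * l j]. *)
  have le_phi y : X <= y -> y < z j -> y <= inverseL Phi (l j).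
    move=> Xy yz; have y0 : 0 < y by lra.
    have [v yv] := lmax _ Xy.
    have vj : (v <= j)%N.
      rewrite leqNgt; apply/negP => jv.
      have := hull_slope_ge X0 mono lM Xy yv jv.
      by rewrite -/(s j) -/(d j) leNgt -ltr_pdivlMr// yz.
    apply: le_inverseL => //; first exact: ltW.
    rewrite -(ler_pM2l y0) (le_trans (PhiM _ Xy))// -yv.
    rewrite lerBlDr ler_wpDr// ler_pM2l// -rj.
    exact: running_max_ge.
  (* In place of a limit [y --> z j], a midpoint (raised to [X] if necessary) gives the
     contradiction. *)
  rewrite leNgt; apply/negP => phiz.
  have := le_phi (Num.max X ((inverseL Phi (l j) + z j) / 2)).
  rewrite le_max lexx gt_max zX/= ge_max => /(_ isT).
  by move=> H; have /H/andP[] : (inverseL Phi (l j) + z j) / 2 < z j; lra.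
exists (\bigcup_j B j); split.
- exact: bigcup_measurable.
- by move=> x [j _ /B1].
- apply: le_trans (ge0_integral_bigcup_le _ _ _ _) _ => //.
  + apply: measurable_funS (classL_measurable_div hL) => //.
    by move=> x [j _ /B1].
  + move=> x [j _ /B1]; rewrite /= in_itv/= andbT => x1.
    rewrite lee_fin divr_ge0//; last lra.
    by case: hL => + _ _ => /(_ x) h0; apply/ltW/h0; lra.
  have phi0 j : 0 <= inverseL Phi (l j) * (1 + e j).
    by rewrite mulr_ge0 ?inverseL_ge0// addr_ge0.
  have hphi0 j : 0 <= h (inverseL Phi (l j) * (1 + e j)).
    by case: hL => + _ _ => /(_ _ (phi0 j))/ltW.
  apply: lee_nneseries => [j _ _|j _].
    apply: integral_ge0 => x /B1; rewrite /= in_itv/= andbT => x1.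
    rewrite lee_fin divr_ge0//; last lra.
    by case: hL => + _ _ => /(_ x) h0; apply/ltW/h0; lra.
  have [Bj|/set0P[x0 Bx0]] := eqVneq (B j) set0.
    by rewrite Bj integral_set0 lee_fin mulr_ge0// mulr_ge0//; exact: e0.
  have zj : 0 < z j by case: Bx0 => _ sj _ _; rewrite divr_gt0.
  apply: (@integral_ball_div_le _ h (B j) (z j) (e j)) => //.
    by move=> x [].
  move=> x Bx; have x1 := B1 _ _ Bx; rewrite /= in_itv/= andbT in x1.
  suff : x < inverseL Phi (l j) * (1 + e j).
    by case: hL => _ _ hi xlt; apply/ltW/hi => //; lra.
  have := ler_wpM2r (e0 j) (z_le _ _ Bx); have := z_le _ _ Bx.
  by case: Bx => _ _ _; rewrite ltr_norml => /andP[_ +]; lra.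
move=> x v n Xx Ex xv.
have x0 : 0 < x by lra.
have Xx' : X <= x by lra.
apply: (@nonmaximal_terms_le _ l m (hull X M m)) => //.
- by move=> i; have := dC i; lra.
- by move=> i; exact: mono.
- by move=> i; exact: lM.
- exact: hull_eq xv.
- by move=> i; exact: le_hull.
- by move=> j; exact: hull_slope_le xv.
- by move=> j; exact: hull_slope_ge xv.
move=> j rj; rewrite leNgt -/(s j) -/(d j); apply/negP => xsd.
(* Since [d j >= 2 * C], an exceptional inequality gives [x * s j > C]. *)
have sj : 0 < s j.
  rewrite -(pmulr_rgt0 _ x0); have := dC j; rewrite -/(d j) => dj.
  by move: xsd; rewrite ltr_norml => /andP[+ _]; lra.
apply: Ex; exists j => //; split => //.
rewrite -(ltr_pM2l sj) -[X in X * `|_|](gtr0_norm sj) -normrM.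
have -> : s j * (x - z j) = x * s j - d j.
  by rewrite /z; field; rewrite gt_eqF.
suff -> : s j * (z j * e j) = C by [].
by rewrite /z /e; field; rewrite !gt_eqF.
Qed.

(** * From tails of the sequences back to the whole series *)

Lemma small_tail (R : realType) (f : nat -> R) (n0 : nat) (e : R) :
  (forall n, (n0 <= n)%N -> 0 <= f n) ->
  (\sum_(n0 <= n <oo) (f n)%:E < +oo)%E -> 0 < e ->
  exists N0, forall N, (N0 <= N)%N ->
    (\sum_(0 <= j <oo) (f (j + N)%N)%:E <= e%:E)%E.
Proof.
move=> f0 fy e0.
(* The values of [f] before [n0] have unknown sign and are replaced by [0]. *)
pose g n := if (n0 <= n)%N then (f n)%:E else 0%E.
have g0 n : (0 <= g n)%E by rewrite /g; case: ifP => // /f0; rewrite lee_fin.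
have gy : (\sum_(0 <= n <oo) g n < +oo)%E.
  by move: fy; rewrite eseries_cond eseries_mkcond.
have := nneseries_tail_cvg gy (fun n _ => g0 n).
move=> /(_ [set y | (y < e%:E)%E]) [|N1 _ tailN].
  by apply: open_ereal_lt'; rewrite lte_fin.
exists (maxn n0 N1) => N; rewrite geq_max => /andP[nN /tailN/=].
rewrite -nneseries_addn// => /ltW; apply: le_trans.
apply: lee_nneseries => [j _ _|j _].
  by rewrite lee_fin f0// (leq_trans nN)// leq_addl.
by rewrite /g (leq_trans nN)// leq_addl.
Qed.

(** No exponent attains the supremum, so each is exceeded by another one; the exponents themselves
    may be bounded. *)
Lemma expo_unbounded (R : realType) (F : dirichlet R) (K : nat) :
  exists k, forall i, (i <= K)%N -> expo F i < expo F k.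
Proof.
have next i : exists k, expo F i < expo F k.
  by have /ereal_sup_gt[_ [k _ <-]] := expo_lt_sup F i; rewrite lte_fin; exists k.
elim: K => [|K [k IHk]].
  by have [k k0] := next 0%N; exists k => i; rewrite leqn0 => /eqP ->.
have [k' Kk'] := next K.+1.
have [Kk|kK] := ltP (expo F K.+1) (expo F k).
  by exists k => i; rewrite leq_eqVlt ltnS => /predU1P[->//|]; exact: IHk.
exists k' => i; rewrite leq_eqVlt ltnS => /predU1P[->//|/IHk ik].
exact: lt_trans (lt_le_trans ik kK) Kk'.
Qed.

(** A term whose exponent exceeds all those of index at most [maxn n0 N] dominates the first [N]
    terms exponentially; its index is beyond [n0], so its coefficient is nonzero. *)
Lemma initial_terms_negligible (R : realType) (F : dirichlet R) (n0 N : nat)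
    (e : R) :
  (forall n, (n0 <= n)%N -> 0 < modulus (coef F n)) -> 0 < e ->
  \forall x \near +oo,
    \sum_(0 <= i < N) real_term F x i <= e * max_term F x.
Proof.
move=> a0 e0.
have [k kP] := expo_unbounded F (maxn n0 N).
have ak : 0 < modulus (coef F k).
  apply: a0; rewrite leqNgt; apply/negP => kn.
  by have := kP k; rewrite ltxx leq_max (ltnW kn) => /(_ isT).
suff H n : (n <= N)%N -> forall d, 0 < d ->
    \forall x \near +oo, \sum_(0 <= i < n) real_term F x i <= d * real_term F x k.
  have := H N (leqnn _) _ e0; apply: filterS => x /le_trans; apply.
  by rewrite ler_pM2l//; case: (central_indexP x ak).
elim: n => [_ d d0|n IHn nN d d0].
  apply: nearW => x; rewrite big_geq// mulr_ge0 ?real_term_ge0//; exact: ltW.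
have d20 : 0 < d / 2 by lra.
have lt_nk : 0 < expo F k - expo F n.
  by rewrite subr_gt0 kP// leq_max (ltnW nN) orbT.
(* Beyond [c], the bound [1 + t <= expR t] makes term [n] at most [d / 2] times term [k]. *)
pose c := modulus (coef F n) / (d / 2 * modulus (coef F k) * (expo F k - expo F n)).
apply: filterS2 (IHn (ltnW nN) _ d20) (nbhs_pinfty_ge (num_real c)) => x IHx cx.
rewrite big_nat_recr//= [d](_ : _ = d / 2 + d / 2); last lra.
rewrite mulrDl lerD// /real_term.
have -> : x * expo F k = x * (expo F k - expo F n) + x * expo F n by lra.
rewrite expRD !mulrA ler_pM2r ?expR_gt0//.
move: cx; rewrite ler_pdivrMr ?mulr_gt0// => /le_trans; apply.
have := expR_ge1Dx (x * (expo F k - expo F n)).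
have dk : 0 < d / 2 * modulus (coef F k) by rewrite mulr_gt0.
by move=> ex; rewrite mulrCA ler_pM2l//; lra.
Qed.

(** [exceptional_set] is applied to the sequences shifted by a large [N]; the first [N] terms
    contribute the extra [e]. *)
Lemma exceptional_set_gap (R : realType) (a : nat -> R) (n0 : nat)
    (mu : nat -> R) (h Phi : R -> R) (F : dirichlet R) (C e : R) :
  (forall n, (n0 <= n)%N -> a n.+1 < a n) ->
  a n @[n --> \oo] --> (0 : R) ->
  (forall n, mu n = - ln (a n)) ->
  (\sum_(n0 <= n <oo) ((mu n.+1 - mu n)^-1)%:E < +oo)%E ->
  classL h -> classL Phi -> classDaPhi a Phi F ->
  (forall n, (n0 <= n)%N -> ((expo F n)%:E < supL Phi)%E) ->
  (\sum_(n0 <= n <oo)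
     (h (inverseL Phi (expo F n) * (1 + C / (mu n.+1 - mu n)))
        * (mu n.+1 - mu n)^-1)%:E < +oo)%E ->
  0 < C -> expR (- C) <= 2^-1 -> 0 < e -> e < 1 ->
  exists E : set R, [/\ measurable E, E `<=` `[1, +oo[,
    (\int[lebesgue_measure]_(x in E) (h x / x)%:E <= e%:E)%E &
    exists X, forall x n, X <= x -> ~ E x ->
      \sum_(0 <= i < n | i != central_index F x) real_term F x i
        <= (10 * expR (- C) + e) * max_term F x].
Proof.
move=> a_decr a_lim muE gap_sum hL PhiL [Fa [x0 FPhi]] phi_def h_sum.
move=> C0 C2 e0 e1.
have a0 n : (n0 <= n)%N -> 0 < a n.
  by move=> /a_decr; apply: le_lt_trans; rewrite -Fa modulus_ge0.
have ak n : (n0 <= n)%N -> 0 < modulus (coef F n) by rewrite Fa; exact: a0.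
have gap0 n : (n0 <= n)%N -> 0 < mu n.+1 - mu n.
  move=> nn; rewrite !muE opprK addrC subr_gt0 ltr_ln ?posrE ?a0 ?a_decr//.
  exact: leqW.
have term_mu x n : (n0 <= n)%N -> real_term F x n = expR (x * expo F n - mu n).
  by move=> nn; rewrite /real_term Fa muE opprK expRD lnK ?posrE ?a0// mulrC.
have CI x := central_indexP x (ak n0 (leqnn _)).
have maxE x : max_term F x = expR (ln (max_term F x)).
  rewrite lnK// posrE (lt_le_trans _ ((CI x).2 n0))//.
  by rewrite mulr_gt0 ?expR_gt0// ak.
(* A tail sum at most [1 / (2 * C)] bounds each of its terms, so the gaps there are at least
   [2 * C]. *)
have [||N1 tail1] := small_tail (e := (2 * C)^-1) _ gap_sum.
  by move=> n /gap0; rewrite invr_ge0 => /ltW.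
  by rewrite invr_gt0; lra.
have hge0 n : (n0 <= n)%N ->
    0 <= h (inverseL Phi (expo F n) * (1 + C / (mu n.+1 - mu n)))
         * (mu n.+1 - mu n)^-1.
  move=> /gap0 gn; rewrite mulr_ge0 ?invr_ge0 ?(ltW gn)//.
  case: hL => + _ _ => h0; apply/ltW/h0.
  by rewrite mulr_ge0 ?inverseL_ge0// addr_ge0// divr_ge0// ltW.
have [|N2 tail2] := small_tail hge0 h_sum (e := e / (4 * C)).
  by rewrite divr_gt0//; lra.
have [N3 _ a1] : \forall n \near \oo, a n < 1 by exact: cvgr_lt a_lim _ ltr01.
pose N := maxn (maxn n0 N1) (maxn N2 N3).
have n0N : (n0 <= N)%N by rewrite /N !leq_max leqnn.
have N1N : (N1 <= N)%N by rewrite /N !leq_max leqnn orbT.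
have N2N : (N2 <= N)%N by rewrite /N !leq_max leqnn !orbT.
have N3N : (N3 <= N)%N by rewrite /N !leq_max leqnn !orbT.
have n0j j : (n0 <= j + N)%N by rewrite (leq_trans n0N)// leq_addl.
have [X0 [_ initX]] := @initial_terms_negligible _ F n0 N e ak e0.
(* The [+ 1] is there because [initX] holds only for [x] strictly above [X0]. *)
pose X := Num.max 1 (Num.max x0 (X0 + 1)).
have X1 : 1 <= X by rewrite le_max lexx.
have Xx0 : x0 <= X by rewrite !le_max lexx orbT.
have XX0 : X0 < X by rewrite !lt_max [X0 < X0 + 1]ltrDl ltr01 !orbT.
have {}initX x : X <= x ->
    \sum_(0 <= i < N) real_term F x i <= e * max_term F x.
  by move=> Xx; apply: initX; exact: lt_le_trans Xx.
have max0 x : 0 < max_term F x by rewrite maxE expR_gt0.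
(* Otherwise the maximal term would be among the first [N], whose sum is at most [e < 1] times
   it. *)
have Ncentral x : X <= x -> (N <= central_index F x)%N.
  move=> /initX; rewrite leqNgt => init; apply/negP => vN.
  suff : max_term F x <= e * max_term F x by rewrite leNgt gtr_pMl ?e1.
  apply: le_trans init; rewrite -(CI x).1 big_mkord (bigD1 (Ordinal vN))//=.
  by rewrite lerDl sumr_ge0// => i _; exact: real_term_ge0.
pose l j := expo F (j + N); pose m j := mu (j + N)%N.
pose M x := ln (max_term F x).
have lME x j : expR (x * l j - m j - M x) = real_term F x (j + N) / max_term F x.
  by rewrite expRD expRN -maxE term_mu.
have centralE x : X <= x -> x * l (central_index F x - N)%N
    - m (central_index F x - N)%N = M x.
  move=> Xx; apply: expR_inj; rewrite -maxE -term_mu// subnK ?Ncentral//.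
  exact: (CI x).1.
have [||||||E [mE E1 intE sumE]] :=
    @exceptional_set _ l m M h Phi X C hL PhiL X1 C0 C2.
- move=> j; have := tail1 (j + N)%N (leq_trans N1N (leq_addl _ _)).
  have f0 i : (0 <= i)%N -> true ->
      (0 <= ((mu (i + (j + N)).+1 - mu (i + (j + N)))^-1)%:E)%E.
    by move=> _ _; rewrite lee_fin invr_ge0 ltW// gap0// addnA n0j.
  move=> /(le_trans (nneseries_lim_ge 1 f0)); rewrite big_nat1 lee_fin add0n.
  by rewrite lef_pV2 ?posrE ?gap0//; lra.
- move=> j; rewrite /m muE oppr_ge0 ln_le0// ltW// a1//=.
  by rewrite (leq_trans N3N)// leq_addl.
- move=> y i Xy; rewrite -ler_expR -maxE -term_mu//; exact: (CI y).2.
- by move=> y /centralE; exists (central_index F y - N)%N.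
- by move=> y Xy; apply: FPhi; exact: le_trans Xy.
- by move=> j; exact: phi_def.
exists E; split => //.
  apply: (le_trans intE) => {intE}.
  rewrite (@eq_eseriesr _ _ (fun j => (4 * C)%:E *
    (h (inverseL Phi (expo F (j + N)) * (1 + C / (mu (j + N).+1 - mu (j + N))))
      * (mu (j + N).+1 - mu (j + N))^-1)%:E)%E); last first.
    by move=> j _; rewrite -EFinM; congr EFin; rewrite /l /m addSn; ring.
  rewrite nneseriesZl; last by move=> j _; rewrite lee_fin hge0.
  rewrite [leRHS](_ : _ = (4 * C)%:E * (e / (4 * C))%:E)%E.
    by apply: lee_wpmul2l; [rewrite lee_fin; lra | exact: tail2].
  by rewrite -EFinM; congr EFin; field; rewrite gt_eqF.
exists (2 * X) => {intE} x n Xx Ex.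
have Xx' : X <= x by lra.
have := sumE x (central_index F x - N)%N n Xx Ex (centralE _ Xx').
under eq_bigr do rewrite lME.
rewrite -mulr_suml ler_pdivrMr// => tail_le.
apply: (@le_trans _ _ (\sum_(0 <= i < N + n | i != central_index F x) real_term F x i)).
  rewrite (@big_cat_nat _ _ _ n 0%N (N + n)%N)//= ?leq_addl// lerDl.
  by apply: sumr_ge0 => i _; exact: real_term_ge0.
rewrite (@big_cat_nat _ _ _ N 0%N (N + n)%N)//= ?leq_addr// addrC mulrDl lerD//.
  rewrite -{1}[N]add0n big_addn addKn (le_trans _ tail_le)// le_eqVlt.
  apply/orP; left; apply/eqP; apply: eq_bigl => i.
  by rewrite -(eqn_add2r N i) subnK// Ncentral.
apply: le_trans (initX _ Xx'); rewrite [leLHS]big_mkcond/=.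
by apply: ler_sum => i _; case: ifP => // _; exact: real_term_ge0.
Qed.

(** * Union of the exceptional sets over integer values of [C] *)

Theorem theorem1p1 (R : realType) (a : nat -> R) (n0 : nat)
    (a_decr : forall n, (n0 <= n)%N -> a n.+1 < a n)
    (a_lim : a n @[n --> \oo] --> (0 : R))
    (mu : nat -> R) (muE : forall n, mu n = - ln (a n))
    (gap_sum : (\sum_(n0 <= n <oo) ((mu n.+1 - mu n)^-1)%:E < +oo)%E)
    (h : R -> R) (hL : classLplus h)
    (Phi : R -> R) (PhiL : classL Phi)
    (F : dirichlet R) (FD : classDaPhi a Phi F)
    (phi_def : forall n, (n0 <= n)%N -> ((expo F n)%:E < supL Phi)%E)
    (h_sum : forall b : R, 0 < b ->
      (\sum_(n0 <= n <oo)
         (h (inverseL Phi (expo F n) * (1 + b / (mu n.+1 - mu n)))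
            * (mu n.+1 - mu n)^-1)%:E < +oo)%E) :
  exists E : set R,
    [/\ measurable E, E `<=` `[0, +oo[, finite_log_measure h E &
        unif_equiv_off E
          (fun x y => dsum F (x +i* y)%C)
          (fun x y => dterm F (central_index F x) (x +i* y)%C)].
Proof.
have [hL' _] := hL.
have a0 : 0 < modulus (coef F n0).
  case: FD => Fa _; rewrite Fa; apply: le_lt_trans (a_decr _ (leqnn _)).
  by rewrite -Fa modulus_ge0.
have max0 x : 0 < max_term F x.
  by apply: lt_le_trans ((central_indexP x a0).2 n0); rewrite mulr_gt0 ?expR_gt0.
have expN k : expR (- (k.+1%:R : R)) <= k.+2%:R^-1.
  by rewrite expRN lef_pV2 ?posrE ?expR_gt0//; exact: expR_ge1Dx.
have pow2 k : (2 ^ k.+1)%:R^-1 <= k.+2%:R^-1 :> R.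
  by rewrite lef_pV2 ?posrE ?ltr0n ?expn_gt0// ler_nat ltn_expl.
have half k : k.+2%:R^-1 <= 2^-1 :> R by rewrite lef_pV2 ?posrE// ler_nat.
(* With [C = k + 1] and [e = 2 ^ -(k + 1)], both [expR (- C)] and [e] are at most [1 / (k + 2)],
   whence the [11]; the measures sum to at most [1]. *)
have /choice[E EP] : forall k : nat, exists E : set R,
    [/\ measurable E, E `<=` `[1, +oo[,
    (\int[lebesgue_measure]_(x in E) (h x / x)%:E <= (1 / (2 ^ k.+1)%:R)%:E)%E &
    exists X, forall x n, X <= x -> ~ E x ->
      \sum_(0 <= i < n | i != central_index F x) real_term F x i
        <= 11 / k.+2%:R * max_term F x].
  move=> k; have k0 : (0 : R) < k.+1%:R by [].
  have [|||E [mE E1 intE [X sumE]]] := exceptional_set_gap (e := (2 ^ k.+1)%:R^-1)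
      a_decr a_lim muE gap_sum hL' PhiL FD phi_def (h_sum _ k0) k0.
  - exact: le_trans (half k).
  - by rewrite invr_gt0 ltr0n expn_gt0.
  - by rewrite (le_lt_trans (pow2 k))// (le_lt_trans (half k))//; lra.
  exists E; rewrite div1r; split => //; exists X => x n Xx Ex.
  apply: le_trans (sumE x n Xx Ex) _.
  rewrite ler_pM2r// (_ : 11 = 10 + 1 :> R); last lra.
  by rewrite [leRHS]mulrDl lerD ?ler_pM2l ?mul1r.
have mE : measurable (\bigcup_k E k) by apply: bigcup_measurable => k _; case: (EP k).
have E1 : \bigcup_k E k `<=` `[1, +oo[ by move=> x [k _ Ekx]; case: (EP k) => _ + _ _; apply.
exists (\bigcup_k E k); split => //.
- by move=> x /E1; rewrite /= !in_itv/= !andbT; exact: le_trans.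
- rewrite /finite_log_measure setIidl//.
  have h0 x : `[1, +oo[%classic x -> (0 <= (h x / x)%:E)%E.
    rewrite /= in_itv/= andbT lee_fin => x1; rewrite divr_ge0//; last lra.
    by case: hL' => + _ _ => /(_ x) hx; apply/ltW/hx; lra.
  apply: le_lt_trans (ge0_integral_bigcup_le _ _ _ _) _.
  + by move=> k; case: (EP k).
  + exact: measurable_funS (classL_measurable_div hL').
  + by move=> x /E1/h0.
  apply: (@le_lt_trans _ _ (1%:E : \bar R)); last by rewrite ltry.
  apply: le_trans (epsilon_trick0 xpredT ler01).
  apply: lee_nneseries => [k _ _|k _].
    by apply: integral_ge0 => x Ekx; apply/h0; case: (EP k) => _ + _ _; apply.
  by case: (EP k).
exists (fun x y => dsum F (x +i* y)%C / dterm F (central_index F x) (x +i* y)%C - 1).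
have modulus_central x y :
    modulus (dterm F (central_index F x) (x +i* y)%C) = max_term F x.
  by rewrite modulus_dterm; case: (central_indexP x a0).
have central_neq0 x y : dterm F (central_index F x) (x +i* y)%C != 0.
  apply/eqP => t0; have := max0 x; rewrite -(modulus_central x y) t0.
  by rewrite /modulus Normc.normc0 ltxx.
split.
  by apply: nearW => x _ y; rewrite addrC subrK divfK.
move=> e e0.
(* One [k] with [11 / (k + 2) <= e] suffices, since a point outside the union is outside [E k]. *)
pose k := Num.bound (11 / e).
have [_ _ _ [X sumE]] := EP k.
apply: filterS (nbhs_pinfty_ge (num_real X)) => x Xx Ex y.
have {}sumE n := sumE x n Xx (fun Ekx => Ex (ex_intro2 _ _ k I Ekx)).
have t0 := central_neq0 x y; have := dsum_approx y sumE.
set t := dterm _ _ _ in t0 *; set G := dsum _ _ => Gt.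
have -> : G / t - 1 = (G - t) / t by rewrite mulrBl divff.
rewrite /modulus Normc.normcM Normc.normcV -!/(modulus _) modulus_central.
rewrite ler_pdivrMr// (le_trans Gt)// ler_pM2r//.
rewrite ler_pdivrMr// mulrC -ler_pdivrMr//.
apply: le_trans (ltW (archi_boundP _)) _; first by rewrite divr_ge0// ltW.
by rewrite ler_nat -/k; apply: leqW; exact: leqnSn.
Qed.
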